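(* Let $n>1$ be an integer. The ai-semiring variety $\mathbf{M}_n$ is semisimple, i.e., every subdirectly irreducible member of $\mathbf{M}_n$ is congruence simple.
   Context: An ai-semiring (additively idempotent semiring) is an algebra $(S,+,\cdot)$ of type $(2,2)$ such that $(S,+)$ is a commutative idempotent semigroup, $(S,\cdot)$ is a semigroup, and the identities $x(y+z)\approx xy+xz$ and $(y+z)x\approx yx+zx$ hold (no zero or unit element is part of the signature). For $n>1$, $\mathbf{Sr}(n,1)$ denotes the variety of all ai-semirings satisfying $x^n\approx x$, and $\mathbf{M}_n$ denotes the subvariety of $\mathbf{Sr}(n,1)$ determined by the identity $x^{n-1}+y^{n-1}\approx x^{n-1}y^{n-1}$. An algebra is subdirectly irreducible if it has a least non-identity congruence (in particular, it has at least two elements); it is congruence simple if it has at least two elements and its only congruences are the identity and the universal one. *)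

(* Defs.v *)
From Corelib Require Import RelationClasses.
From mathcomp Require Import all_boot.

Set Implicit Arguments.
Unset Strict Implicit.
Unset Printing Implicit Defensive.

(* The carrier is an arbitrary type: MathComp's semigroupType would require a
   choiceType. No zero and no unit are assumed. *)
Record aiSemiring : Type := AISemiring {
  carrier :> Type;
  sadd : carrier -> carrier -> carrier;
  smul : carrier -> carrier -> carrier;
  saddA : associative sadd;
  saddC : commutative sadd;
  saddI : idempotent_op sadd;
  smulA : associative smul;
  smulDr : right_distributive smul sadd;
  smulDl : left_distributive smul sadd
}.

Declare Scope aisemiring_scope.
Delimit Scope aisemiring_scope with AS.

Notation "x + y" := (sadd x y) : aisemiring_scope.
Notation "x * y" := (smul x y) : aisemiring_scope.

(* x * (x * ... * x) with k factors. There is no unit, so this is meaningful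
   only for k >= 1; the value at k = 0 is the junk value x. *)
Definition sexp (S : aiSemiring) (x : S) (k : nat) : S :=
  iterop k (@smul S) x x.

Notation "x ^+ k" := (sexp x k) : aisemiring_scope.

Definition congruence (S : aiSemiring) (theta : S -> S -> Prop) : Prop :=
  [/\ Equivalence theta,
      forall a b c d, theta a b -> theta c d -> theta (a + c)%AS (b + d)%AS
    & forall a b c d, theta a b -> theta c d -> theta (a * c)%AS (b * d)%AS].

Definition is_identity (S : aiSemiring) (theta : S -> S -> Prop) : Prop :=
  forall x y, theta x y <-> x = y.

Definition is_universal (S : aiSemiring) (theta : S -> S -> Prop) : Prop :=
  forall x y, theta x y.

Definition subdirectly_irreducible (S : aiSemiring) : Prop :=
  exists mu : S -> S -> Prop,
    [/\ congruence mu, ~ is_identity mu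
      & forall theta : S -> S -> Prop,
          congruence theta -> ~ is_identity theta -> subrelation mu theta].

Definition congruence_simple (S : aiSemiring) : Prop :=
  (exists x y : S, x <> y) /\
  (forall theta : S -> S -> Prop,
     congruence theta -> is_identity theta \/ is_universal theta).

(* Classes of ai-semirings, in particular varieties, are predicates on
   [aiSemiring]. *)
Definition Sr (n : nat) (S : aiSemiring) : Prop :=
  forall x : S, (x ^+ n)%AS = x.

Definition M (n : nat) (S : aiSemiring) : Prop :=
  Sr n S /\
  forall x y : S,
    (x ^+ n.-1 + y ^+ n.-1)%AS = (x ^+ n.-1 * y ^+ n.-1)%AS.

Definition semisimple (V : aiSemiring -> Prop) : Prop :=
  forall S : aiSemiring, V S -> subdirectly_irreducible S -> congruence_simple S.

(* Main.v *)
(** For an idempotent [e], central by regularity, let [G_e] be the group of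
    units of [e * S].  The map sending [x] to [x * e] when [x * e] lies in
    [G_e], and to an absorbing top element otherwise, is a homomorphism onto
    the flat extension of [G_e]: if [c + d = e] with [c], [d] in [e * S], then
    the powers of [c] decrease, so [c] is idempotent, and [c + e = c * e]
    forces [c = e].  The kernels of these maps separate points, so in a
    subdirectly irreducible member one of them is the identity, and flat
    extensions of groups are congruence simple. *)
Require Import Defs.
From mathcomp Require Import all_boot.
From Stdlib Require Import Classical.

Set Implicit Arguments.
Unset Strict Implicit.
Unset Printing Implicit Defensive.

Local Open Scope aisemiring_scope.

Section Powers.

Variable S : aiSemiring.
Implicit Types (x e : S) (j k : nat).

Lemma sexpS x k : x ^+ k.+2 = x * x ^+ k.+1.
Proof. by []. Qed.

Lemma sexpD x j k : x ^+ (j.+1 + k.+1) = x ^+ j.+1 * x ^+ k.+1.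
Proof.
elim: j => [|j IHj]; first by rewrite add1n sexpS.
by rewrite addSn addSn sexpS -addSn IHj smulA -sexpS.
Qed.

Lemma sexp_idem e k : e * e = e -> e ^+ k.+1 = e.
Proof. by move=> ee; elim: k => [|k IHk] //; rewrite sexpS IHk. Qed.

(* The exponent [2m + 1] is used instead of [m] because [sexpS] and [sexpD]
   fail at exponent 0. *)
Lemma sexp_regular x m :
  x ^+ m.+2 = x ->
  x * x ^+ (m + m).+1 = x ^+ (m + m).+1 * x /\ x * x ^+ (m + m).+1 * x = x.
Proof.
move=> xm; have xC : x * x ^+ (m + m).+1 = x ^+ (m + m).+1 * x.
  by rewrite -sexpS -addn1 sexpD.
split=> //; rewrite -smulA -xC -!sexpS.
rewrite (_ : (m + m).+3 = (m.+1 + m.+2)%N); last by rewrite addSn !addnS.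
by rewrite sexpD xm -[X in _ * X]/(x ^+ 1) -sexpD addn1.
Qed.

(** Read [a + b = b] as [a] lying below [b]. The square lies below [x], so all higher powers lie
    below the square, among them [x ^+ m.+2], which is [x]. *)
Lemma idem_of_sq_le x m : x ^+ m.+2 = x -> x * x + x = x -> x * x = x.
Proof.
move=> xm le2; have le k : x ^+ k.+2 + x * x = x * x.
  elim: k => [|k IHk]; first exact: saddI.
  have lek : x ^+ k.+3 + x * (x * x) = x * (x * x) by rewrite sexpS -smulDr IHk.
  have le3 : x * (x * x) + x * x = x * x by rewrite -smulDr le2.
  by rewrite -{1}le3 saddA lek.
by rewrite -[LHS](le m) xm saddC.
Qed.

End Powers.

Section Regular.

Variables (S : aiSemiring) (inv : S -> S).
Hypothesis mulVC : forall x : S, x * inv x = inv x * x.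
Hypothesis mulVK : forall x : S, x * inv x * x = x.
Hypothesis idemD :
  forall e f : S, e * e = e -> f * f = f -> e + f = e * f.
Hypothesis sq_le_idem : forall x : S, x * x + x = x -> x * x = x.
Implicit Types (x y z u c d e f : S).

Lemma idemC e f : e * e = e -> f * f = f -> e * f = f * e.
Proof. by move=> ee ff; rewrite -(idemD ee ff) -(idemD ff ee) saddC. Qed.

Lemma mulV_idem x : (x * inv x) * (x * inv x) = x * inv x.
Proof. by rewrite smulA mulVK. Qed.

(** If [e] fixes [y] on one side, it fixes the idempotent [y * inv y]; idempotents commute, so [e]
    fixes [y] on the other side too. Hence [e * x] and [x * e] both equal [e * x * e]. *)
Lemma idem_central e x : e * e = e -> e * x = x * e.
Proof.
move=> ee.
have eL y : e * y = y -> y * e = y.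
  move=> ey; have pe : y * inv y * e = y * inv y.
    by rewrite (idemC (mulV_idem y) ee) smulA ey.
  by rewrite -{1}(mulVK y) -(smulA y) -mulVC -smulA pe mulVC smulA mulVK.
have eR y : y * e = y -> e * y = y.
  move=> ye; have ep : e * (y * inv y) = y * inv y.
    by rewrite -(idemC (mulV_idem y) ee) mulVC -smulA ye.
  by rewrite -{1}(mulVK y) smulA ep mulVK.
rewrite -(eL (e * x)); last by rewrite smulA ee.
by rewrite -smulA eR // -smulA ee.
Qed.

Lemma idem_top e c d :
  e * e = e -> c * e = c -> c + d = e -> c = e.
Proof.
move=> ee ce cd.
have ce1 : c + e = e by rewrite -cd saddA saddI.
have cc : c * c = c by apply: sq_le_idem; rewrite -{3 4}ce -smulDr ce1.
by rewrite -ce -(idemD cc ee).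
Qed.

(* Since [e] is central, this says that [x * e] is a unit of [e * S]. *)
Definition unit_at e x := exists u, x * u * e = e.

Lemma unit_at_mulV e x : unit_at e x -> x * inv x * e = e.
Proof. by case=> u xu; rewrite -{1}xu !smulA mulVK. Qed.

(** The idempotent [inv x * x] fixes [x], hence also [u * x * e], which is [e]. *)
Lemma unit_at_left e x u : e * e = e -> u * x * e = e -> unit_at e x.
Proof.
move=> ee ux; exists (inv x); rewrite -(idem_central _ ee) -{1}ux.
by rewrite -smulA (idem_central _ ee) mulVC !smulA -(smulA u x) -(smulA u _ x) mulVK.
Qed.

Lemma unit_at_idem e : e * e = e -> unit_at e e.
Proof. by move=> ee; exists e; rewrite !ee. Qed.

Lemma unit_atM e x y :
  e * e = e -> unit_at e (x * y) <-> unit_at e x /\ unit_at e y.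
Proof.
move=> ee; split=> [xy | [[u xu] [v yv]]].
  split; first by case: xy => u; exists (y * u); rewrite smulA.
  apply: (@unit_at_left e y (inv (x * y) * x)) => //.
  by rewrite -(smulA (inv _)) -mulVC unit_at_mulV.
exists (v * u); rewrite !smulA -(smulA _ u) -(idem_central u ee) smulA.
by rewrite -(smulA x y) -(smulA x _ e) yv -smulA (idem_central u ee) smulA.
Qed.

(** If [u] inverts [x + y] at [e], then [idem_top], applied to each summand of
    [x * u * e + y * u * e], shows that the same [u] inverts [x] and [y]; inverses in a group
    determine the element. *)
Lemma unit_atD e x y :
  e * e = e -> unit_at e (x + y) ->
  [/\ unit_at e x, unit_at e y & x * e = y * e].
Proof.
move=> ee [u]; rewrite !smulDl => xyu.
have xu : x * u * e = e by apply: idem_top xyu; rewrite // -smulA ee.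
have yu : y * u * e = e.
  by rewrite saddC in xyu; apply: idem_top xyu; rewrite // -smulA ee.
have ux : unit_at e x by exists u.
have uy : unit_at e y by exists u.
have ue z : z * u * e = e -> u * e = inv z * e.
  move=> zu; have zV : z * inv z * e = e by apply: unit_at_mulV; exists u.
  by rewrite -[in RHS]zu !smulA -mulVC -smulA -(idem_central u ee) smulA zV.
split=> //.
rewrite -(idem_central y ee) -{2}xu -(smulA x) (ue y yu) -smulA.
rewrite -(smulA (inv y)) (idem_central y ee) (smulA (inv y)) -mulVC.
by rewrite unit_at_mulV.
Qed.

Definition flat_ker e x y :=
  [/\ unit_at e x, unit_at e y & x * e = y * e] \/
  (~ unit_at e x /\ ~ unit_at e y).

Lemma unit_at_eq e x y : e * e = e -> x * e = y * e -> unit_at e x -> unit_at e y.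
Proof.
move=> ee xy [u xu]; exists u.
by rewrite -smulA -(idem_central u ee) smulA -xy -smulA (idem_central u ee) smulA.
Qed.

Lemma flat_ker_congruence e : e * e = e -> congruence (flat_ker e).
Proof.
move=> ee; split.
- split.
  + by move=> x; case: (classic (unit_at e x)) => ux; [left | right].
  + by move=> x y [[ux uy xy] | [ux uy]]; [left | right].
  + move=> x y z [[ux uy xy] | [ux uy]] [[uy' uz yz] | [uy' uz]] //.
      by left; split=> //; rewrite xy.
    by right.
- move=> a b c d [[ua ub ab] | [ua ub]] [[uc ud cd] | [uc ud]].
  + have abcd : (a + c) * e = (b + d) * e by rewrite !smulDl ab cd.
    case: (classic (unit_at e (a + c))) => uac.
      by left; split=> //; apply: unit_at_eq uac.
    by right; split=> // ubd; apply: uac; apply: unit_at_eq ubd.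
  + by right; split=> /(unit_atD ee)[].
  + by right; split=> /(unit_atD ee)[].
  + by right; split=> /(unit_atD ee)[].
- move=> a b c d [[ua ub ab] | [ua ub]] [[uc ud cd] | [uc ud]].
  + left; split; [exact/unit_atM | exact/unit_atM |].
    rewrite -smulA cd -(idem_central d ee) smulA ab.
    by rewrite -smulA (idem_central d ee) smulA.
  + by right; split=> /(unit_atM _ _ ee)[].
  + by right; split=> /(unit_atM _ _ ee)[].
  + by right; split=> /(unit_atM _ _ ee)[].
Qed.

(** Each element is then a unit at the idempotent of the other, so the two idempotents absorb each
    other and coincide; this common idempotent fixes both [a] and [b]. *)
Lemma flat_ker_separates a b :
  flat_ker (a * inv a) a b -> flat_ker (b * inv b) a b -> a = b.
Proof.
have uV x : unit_at (x * inv x) x by exists (inv x); rewrite mulV_idem.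
have xV x : x * (x * inv x) = x by rewrite mulVC smulA mulVK.
set e := a * inv a; set f := b * inv b.
have ee : e * e = e := mulV_idem a.
have ff : f * f = f := mulV_idem b.
case=> [[_ ub ab] | [/(_ (uV a))] //].
case=> [[ua _ ba] | [_ /(_ (uV b))] //].
have fe : f * e = e := unit_at_mulV ub.
have ef : e * f = f := unit_at_mulV ua.
have eqef : e = f by rewrite -fe (idemC ff ee).
by rewrite -[a]xV -[b]xV -/e -/f -eqef.
Qed.

Lemma flat_congruence_universal e (rho : S -> S -> Prop) x y :
  e * e = e -> (forall x y, flat_ker e x y -> x = y) ->
  congruence rho -> rho x y -> x <> y -> is_universal rho.
Proof.
move=> ee flat [[rR rS rT] rD rM].
have mulxe z : z * e = z.
  apply: flat; have [uz | uz] := classic (unit_at e z).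
    left; split=> //; last by rewrite -smulA ee.
    by apply/unit_atM=> //; split=> //; exact: unit_at_idem.
  by right; split=> // /(unit_atM _ _ ee)[].
(* Multiplying by [w] relates [w] to the non-unit [w * t], and [flat] makes all non-units equal. *)
have top_univ t : ~ unit_at e t -> rho e t -> is_universal rho.
  move=> ut et z z'.
  have zt w : rho w (w * t) by rewrite -{1}(mulxe w); apply: rM.
  have ztE : z * t = z' * t.
    by apply: flat; right; split=> /(unit_atM _ _ ee)[].
  by apply: (rT _ (z * t)) => //; rewrite ztE; apply: rS.
have unit_univ x' y' : unit_at e x' -> rho x' y' -> x' <> y' -> is_universal rho.
  move=> ux xy nxy.
  have xV : inv x' * x' = e.
    by rewrite -mulVC -(mulxe (_ * _)) unit_at_mulV.
  have eg : rho e (inv x' * y') by rewrite -xV; apply: rM.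
  (* Were this sum a unit, its summands would agree, forcing [x' = y']. *)
  apply: (top_univ (e + inv x' * y')).
    move=> /(unit_atD ee)[_ _]; rewrite !mulxe => gE; apply: nxy.
    rewrite -(mulxe x') gE smulA mulVC xV.
    by rewrite (idem_central _ ee) mulxe.
  by rewrite -{1}(saddI e); apply: rD.
move=> xy nxy; have [ux | ux] := classic (unit_at e x); first exact: unit_univ xy nxy.
have [uy | uy] := classic (unit_at e y).
  by apply: (unit_univ y x) => //; [exact: rS | exact: nesym].
by case: nxy; apply: flat; right.
Qed.

Lemma regular_simple : subdirectly_irreducible S -> congruence_simple S.
Proof.
have nonidP theta : congruence theta -> ~ is_identity theta ->
    exists x y : S, theta x y /\ x <> y.
  move=> [[tR _ _] _ _] nid; apply: NNPP => none; apply: nid => x y.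
  by split=> [xy | ->]; [apply: NNPP => nxy; apply: none; exists x, y | exact: tR].
case=> mu [muC munid mumin].
have [a [b [ab nab]]] := nonidP mu muC munid.
split; first by exists a, b.
(* A kernel omitting [(a, b)] does not contain [mu], so minimality of [mu] makes it the identity. *)
have [e [ee nsep]] : exists e, e * e = e /\ ~ flat_ker e a b.
  have [sa | sa] := classic (flat_ker (a * inv a) a b).
    exists (b * inv b); split; first exact: mulV_idem.
    by move=> sb; apply: nab; apply: flat_ker_separates.
  by exists (a * inv a); split; first exact: mulV_idem.
have flat x y : flat_ker e x y -> x = y.
  have idflat : is_identity (flat_ker e).
    apply: NNPP => nid; apply: nsep.
    by apply: (mumin _ (flat_ker_congruence ee) nid).
  by move/idflat.
move=> rho rhoC; have [idr | nidr] := classic (is_identity rho); first by left.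
have [x [y [xy nxy]]] := nonidP rho rhoC nidr.
by right; apply: (flat_congruence_universal ee flat rhoC xy nxy).
Qed.

End Regular.

Theorem corollary2p8 (n : nat) (hn : (1 < n)%N) : semisimple (M n).
Proof.
case: n hn => [|[|m]] // _ S [xn joinE].
apply: (@regular_simple S (fun x => x ^+ (m + m).+1)) => [x|x|e f ee ff|x].
- by have [] := sexp_regular (xn x).
- by have [] := sexp_regular (xn x).
(* Idempotents equal their powers of exponent [m.+1], which is [n.-1]. *)
- by rewrite -(sexp_idem m ee) -(sexp_idem m ff) joinE.
- exact: idem_of_sq_le (xn x).
Qed.
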